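(* Let $G$ be a commutative group, and for each $n\in\mathbb{N}$ let $f_n\colon G\to\mathbb{C}$ be a function. If the sequence $(f_n)_{n\in\mathbb{N}}$ forms a generalized moment sequence, then there exist an exponential $m\colon G\to\mathbb{C}$ and a sequence $(a_k)_{k\ge1}$ of additive functions $a_k\colon G\to\mathbb{C}$ such that $$f_n(x)=B_n\left(a_1(x),\ldots,a_n(x)\right)m(x)$$ holds for every $x\in G$ and $n=1,2,\ldots$, where $B_n$ is the $n$-th complete (exponential) Bell polynomial.
   Context: $\mathbb{N}$ is the set of nonnegative integers; groups are written additively. An exponential on $G$ is a function $m\colon G\to\mathbb{C}$, not identically zero, with $m(x+y)=m(x)m(y)$ for all $x,y\in G$. An additive function is a homomorphism $G\to(\mathbb{C},+)$. A sequence $(f_n)_{n\in\mathbb{N}}$ of functions $f_n\colon G\to\mathbb{C}$ is a generalized moment sequence if $f_0(0)=1$ and $$f_n(x+y)=\sum_{j=0}^{n}\binom{n}{j}f_j(x)f_{n-j}(y)$$ for all $n\in\mathbb{N}$ and $x,y\in G$. The complete (exponential) Bell polynomials are defined by $B_0=1$ and, for $n=0,1,2,\ldots$, $$B_{n+1}(t_1,\ldots,t_{n+1})=\sum_{i=0}^{n}\binom{n}{i}B_{n-i}(t_1,\ldots,t_{n-i})\,t_{i+1};$$ equivalently $\exp\left(\sum_{j=1}^\infty x_j\frac{t^j}{j!}\right)=\sum_{n=0}^\infty B_n(x_1,\ldots,x_n)\frac{t^n}{n!}$ as formal power series. *)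

(* Defs.v *)
(* The field of complex numbers is R[i] for an arbitrary R : realType. *)
From HB Require Import structures.
From mathcomp Require Import all_boot all_order all_algebra.
From mathcomp Require Import reals.
From mathcomp Require Import complex.

Set Implicit Arguments.
Unset Strict Implicit.
Unset Printing Implicit Defensive.
Import GRing.Theory.
Local Open Scope ring_scope.

Definition exponential (R : realType) (G : zmodType) (m : G -> R[i]) : Prop :=
  (exists x, m x != 0) /\ (forall x y, m (x + y) = m x * m y).

Definition generalized_moment_sequence (R : realType) (G : zmodType)
    (f : nat -> G -> R[i]) : Prop :=
  f 0%N 0 = 1 /\
  forall (n : nat) (x y : G),
    f n (x + y) = \sum_(j < n.+1) 'C(n, j)%:R * f j x * f (n - j)%N y.

(* [bell n t] is the value B_n(t 1, ..., t n) in an arbitrary commutative ring;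
   taking polynomial indeterminates for the t k gives B_n itself, and [rmorph_bell]
   then describes its evaluations. The entries t 0 and t k for n < k are not used
   (see [eq_bell]). [bell_seq n t] is the list B_0, ..., B_n; the recursion
   defining B_{n+1} is [bellS]. *)
Fixpoint bell_seq (R : comNzRingType) (n : nat) (t : nat -> R) : seq R :=
  if n is k.+1 then
    let s := bell_seq k t in
    rcons s (\sum_(i < k.+1) 'C(k, i)%:R * nth 0 s (k - i) * t i.+1)
  else [:: 1].

Definition bell (R : comNzRingType) (n : nat) (t : nat -> R) : R :=
  nth 0 (bell_seq n t) n.

Lemma size_bell_seq (R : comNzRingType) n (t : nat -> R) :
  size (bell_seq n t) = n.+1.
Proof. by elim: n => //= n IHn; rewrite size_rcons IHn. Qed.

Lemma nth_bell_seq (R : comNzRingType) n k (t : nat -> R) :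
  (k <= n)%N -> nth 0 (bell_seq n t) k = bell k t.
Proof.
elim: n => [|n IHn]; first by rewrite leqn0 => /eqP->.
rewrite leq_eqVlt => /orP[/eqP-> //|]; rewrite ltnS => le_kn /=.
by rewrite nth_rcons size_bell_seq ltnS le_kn IHn.
Qed.

Lemma bell0 (R : comNzRingType) (t : nat -> R) : bell 0 t = 1.
Proof. by []. Qed.

Lemma bellS (R : comNzRingType) n (t : nat -> R) :
  bell n.+1 t = \sum_(i < n.+1) 'C(n, i)%:R * bell (n - i) t * t i.+1.
Proof.
rewrite /bell /= nth_rcons size_bell_seq ltnn eqxx.
by apply: eq_bigr => i _; rewrite nth_bell_seq ?leq_subr.
Qed.

Lemma eq_bell (R : comNzRingType) n (t u : nat -> R) :
  (forall k, (0 < k <= n)%N -> t k = u k) -> bell n t = bell n u.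
Proof.
elim/ltn_ind: n => -[|n] IHn tu; first by rewrite !bell0.
rewrite !bellS; apply: eq_bigr => i _.
rewrite tu ?ltn_ord // (IHn (n - i)%N) ?ltnS ?leq_subr // => k /andP[k_gt0 le_k].
by apply: tu; rewrite k_gt0 (leq_trans le_k) // (leq_trans (leq_subr _ _)).
Qed.

Lemma rmorph_bell (R S : comNzRingType) (h : {rmorphism R -> S}) n
    (t : nat -> R) : h (bell n t) = bell n (fun k => h (t k)).
Proof.
elim/ltn_ind: n => -[|n] IHn; first by rewrite !bell0 rmorph1.
rewrite !bellS rmorph_sum; apply: eq_bigr => i _.
by rewrite !rmorphM rmorph_nat IHn // ltnS leq_subr.
Qed.

(* Main.v *)
(* Binomial convolution [(u * v)_n = \sum_j C(n,j) u_j v_(n-j)] is the product of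
   exponential generating functions, and the shift [u |-> u_(.+1)] is a derivation
   for it. The Bell recursion reads [B' = t' * B], so [B(s) * B(t)] solves the
   equation defining [B(s + t)]. Dividing by the exponential [f_0], one may assume
   [f_0 = 1]; solving the Bell recursion for [t] then gives [a_k(x)] with
   [f_n(x) = B_n(a(x))], and the moment equation becomes
   [B_n(a(x + y)) = B_n(a(x) + a(y))] for all [n]. Since a sequence [t] is
   determined, from index 1 on, by its Bell values, each [a_k] is additive. *)
Require Import Defs.
From HB Require Import structures.
From mathcomp Require Import all_boot all_order all_algebra.
From mathcomp Require Import reals.
From mathcomp Require Import complex.
Import GRing.Theory.
Local Open Scope ring_scope.

Section BinomialConvolution.
Variable K : comNzRingType.
Implicit Types u v w s t : nat -> K.

Definition bconv u v (n : nat) : K :=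
  \sum_(j < n.+1) 'C(n, j)%:R * u j * v (n - j)%N.

Definition shift u (n : nat) : K := u n.+1.

Lemma bconv0 u v : bconv u v 0 = u 0%N * v 0%N.
Proof. by rewrite /bconv big_ord1 mul1r. Qed.

(** Pascal's rule splits each term with [j > 0]. The coefficients C(n,j-1) give the first summand;
    the [j = 0] term and the C(n,j) give the second. *)
Lemma bconvS u v n :
  bconv u v n.+1 = bconv (shift u) v n + bconv u (shift v) n.
Proof.
rewrite /bconv /shift big_ord_recl.
under eq_bigr => j _ do rewrite lift0 binS natrD !mulrDl addrC subSS.
rewrite big_split /= addrCA; congr (_ + _).
rewrite [X in _ + X = _]big_ord_recr /= (bin_small (ltnSn n)) !mul0r addr0.
rewrite [RHS]big_ord_recl !bin0 !subn0.
congr (_ + _); apply: eq_bigr => j _.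
by rewrite lift0 subnSK.
Qed.

Lemma eq_bconv u1 u2 v1 v2 n :
    (forall k, (k <= n)%N -> u1 k = u2 k) ->
    (forall k, (k <= n)%N -> v1 k = v2 k) ->
  bconv u1 v1 n = bconv u2 v2 n.
Proof.
move=> eq_u eq_v; apply: eq_bigr => j _.
by rewrite eq_u -1?ltnS // eq_v // leq_subr.
Qed.

Lemma bconvC u v n : bconv u v n = bconv v u n.
Proof.
elim: n u v => [|n IHn] u v; first by rewrite !bconv0 mulrC.
by rewrite !bconvS addrC (IHn u) (IHn (shift u)).
Qed.

Lemma bconvDl u v w n :
  bconv (fun k => u k + v k) w n = bconv u w n + bconv v w n.
Proof.
by rewrite -big_split; apply: eq_bigr => j _; rewrite mulrDr mulrDl.
Qed.

Lemma bconvDr u v w n :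
  bconv u (fun k => v k + w k) n = bconv u v n + bconv u w n.
Proof. by rewrite bconvC bconvDl ![bconv _ u n]bconvC. Qed.

Lemma bconvA u v w n : bconv u (bconv v w) n = bconv (bconv u v) w n.
Proof.
have shift_bconv u1 v1 k :
    shift (bconv u1 v1) k = bconv (shift u1) v1 k + bconv u1 (shift v1) k.
  exact: bconvS.
elim: n u v w => [|n IHn] u v w; first by rewrite !bconv0 mulrA.
rewrite !bconvS (eq_bconv u u _ _ n (fun _ _ => erefl) (fun k _ => shift_bconv v w k)).
rewrite (eq_bconv _ _ w w n (fun k _ => shift_bconv u v k) (fun _ _ => erefl)).
by rewrite bconvDr bconvDl !IHn addrA.
Qed.

Lemma bellS_bconv t n : bell n.+1 t = bconv (shift t) (fun k => bell k t) n.
Proof. by rewrite bellS; apply: eq_bigr => i _; rewrite mulrAC. Qed.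

Lemma bellD s t n :
  bell n (fun k => s k + t k) = bconv (fun k => bell k s) (fun k => bell k t) n.
Proof.
elim/ltn_ind: n => -[|n] IHn; first by rewrite bconv0 !bell0 mulr1.
rewrite bellS_bconv (eq_bconv _ (fun k => shift s k + shift t k) _
  (bconv (fun k => bell k s) (fun k => bell k t)) n) => [|//|k]; last exact: IHn.
rewrite bconvDl bconvS bconvA; congr (_ + _).
  by apply: eq_bconv => k _; rewrite // /shift bellS_bconv.
(* Swap the two Bell sequences, so that associativity brings [shift t] next to the Bell values of
   [t]. *)
rewrite (eq_bconv _ _ _ _ n (fun _ _ => erefl) (fun k _ => bconvC _ _ k)).
rewrite bconvA bconvC.
by apply: eq_bconv => k _; rewrite // /shift bellS_bconv.
Qed.

(** The top entry [t n.+1] has coefficient 1, so the Bell recursion is unitriangular in [t] and can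
    be solved over any [K]. *)
Lemma bellS_recr t n :
  bell n.+1 t =
    \sum_(i < n) 'C(n, i)%:R * bell (n - i) t * t i.+1 + t n.+1.
Proof. by rewrite bellS big_ord_recr /= binn subnn bell0 !mul1r. Qed.

Lemma bell_inj s t n : (forall k, bell k s = bell k t) -> s n.+1 = t n.+1.
Proof.
move=> eq_bell_st; elim/ltn_ind: n => n IHn.
have := eq_bell_st n.+1; rewrite !bellS_recr.
rewrite (eq_bigr (fun i : 'I_n => 'C(n, i)%:R * bell (n - i) t * t i.+1)).
  by move/addrI.
by move=> i _; rewrite eq_bell_st IHn.
Qed.

(* The list [t_0, ..., t_n] solving [bell k t = g k]; the unused entry [t_0] is 0. *)
Fixpoint cumulant_seq (g : nat -> K) (n : nat) : seq K :=
  if n is k.+1 then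
    let s := cumulant_seq g k in
    rcons s (g k.+1 - \sum_(i < k) 'C(k, i)%:R * g (k - i)%N * nth 0 s i.+1)
  else [:: 0].

(** When [g 0 = 1], these are formally the coefficients of the logarithm of the exponential
    generating function of [g]. *)
Definition cumulant (g : nat -> K) (n : nat) : K := nth 0 (cumulant_seq g n) n.

Lemma size_cumulant_seq g n : size (cumulant_seq g n) = n.+1.
Proof. by elim: n => //= n IHn; rewrite size_rcons IHn. Qed.

Lemma nth_cumulant_seq g n k :
  (k <= n)%N -> nth 0 (cumulant_seq g n) k = cumulant g k.
Proof.
elim: n => [|n IHn]; first by rewrite leqn0 => /eqP->.
rewrite leq_eqVlt => /orP[/eqP-> //|]; rewrite ltnS => le_kn /=.
by rewrite nth_rcons size_cumulant_seq ltnS le_kn IHn.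
Qed.

Lemma cumulantS g n :
  cumulant g n.+1 =
    g n.+1 - \sum_(i < n) 'C(n, i)%:R * g (n - i)%N * cumulant g i.+1.
Proof.
rewrite /cumulant /= nth_rcons size_cumulant_seq ltnn eqxx.
by congr (_ - _); apply: eq_bigr => i _; rewrite nth_cumulant_seq.
Qed.

Lemma bell_cumulant g n : g 0%N = 1 -> bell n (cumulant g) = g n.
Proof.
move=> g0; elim/ltn_ind: n => -[|n] IHn; first by rewrite bell0.
rewrite bellS_recr cumulantS addrC.
under [X in _ + X]eq_bigr => i _ do rewrite IHn ?ltnS ?leq_subr //.
by rewrite subrK.
Qed.

Lemma cumulantD (G : zmodType) (g : nat -> G -> K) n (x y : G) :
    (forall z, g 0%N z = 1) ->
    (forall k z z', g k (z + z') = bconv (g^~ z) (g^~ z') k) ->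
  cumulant (g^~ (x + y)) n = cumulant (g^~ x) n + cumulant (g^~ y) n.
Proof.
(* [bell_inj] says nothing about index 0; there every cumulant is 0 by convention. *)
move=> g0 gD; case: n => [|n]; first by rewrite addr0.
apply: (bell_inj _ (fun k => cumulant (g^~ x) k + cumulant (g^~ y) k)) => k.
rewrite bellD bell_cumulant // gD.
by apply: eq_bconv => j _; rewrite bell_cumulant.
Qed.

End BinomialConvolution.

Theorem corollary2 (R : realType) (G : zmodType) (f : nat -> G -> R[i])
    (hf : generalized_moment_sequence f) :
  exists (m : G -> R[i]) (a : nat -> {additive G -> R[i]}),
    exponential m /\
    forall (x : G) (n : nat), (1 <= n)%N ->
      f n x = bell n (fun k => a k x) * m x.
Proof.
case: hf => f00 fD.
have f0D x y : f 0%N (x + y) = f 0%N x * f 0%N y by rewrite fD big_ord1 mul1r.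
(* The product of [f 0 x] and [f 0 (- x)] is [f 0 0 = 1]. *)
have f0_neq0 x : f 0%N x != 0.
  apply/eqP => f0x; have /eqP := f0D x (- x).
  by rewrite subrr f00 f0x mul0r oner_eq0.
pose g n x := f n x / f 0%N x.
have g0 x : g 0%N x = 1 by rewrite /g divff.
have gD n x y : g n (x + y) = bconv _ (g^~ x) (g^~ y) n.
  rewrite /g fD f0D invfM mulr_suml; apply: eq_bigr => j _.
  by rewrite mulrACA !mulrA.
pose c k x := cumulant _ (g^~ x) k.
have cB k : zmod_morphism (c k).
  (* Compatibility with subtraction follows from additivity applied to [x = (x - y) + y]. *)
  move=> x y; apply: (addIr (c k y)).
  by rewrite subrK -[in RHS](subrK y x) /c [RHS]cumulantD.
pose a k : {additive G -> R[i]} :=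
  HB.pack (c k) (GRing.isZmodMorphism.Build _ _ (c k) (cB k)).
exists (f 0%N), a; split.
  by split=> //; exists 0; rewrite f00 oner_neq0.
move=> x n _; rewrite [bell _ _](bell_cumulant _ (g^~ x)) //.
by rewrite /g divfK.
Qed.
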